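(* Let $n,p$ be positive integers, let $a_{i,j},b_{i,j}>0$ be arbitrary positive weights, and let $K_{n,p}$ be the (ordered) Kasteleyn matrix of the tower Aztec diamond of size $n$ with corridor of size $p$. Let $B_{n,p}=K_{n,p}[1;n+p,\,n+p+1;n(2n+p)]$, $C_{n,p}=K_{n,p}[n+p+1;n(2n+p),\,1;n+p]$ and $D_{n,p}=K_{n,p}[n+p+1;n(2n+p),\,n+p+1;n(2n+p)]$. For $1\le i,j\le n+p$ let $$\tilde w_{ij}=(-B_{n,p}D_{n,p}^{-1}C_{n,p})(i,j)$$ and $\tilde W_{n,p}^{\mathrm{Tow}}=(\tilde w_{ij})_{i,j=1}^{n+p}$. Then, up to sign, $\tilde W_{n,p}^{\mathrm{Tow}}$ is equal to the LGV matrix for the tower Aztec diamond of size $n$ with corridor $p$, and $$|\det \tilde W_{n,p}^{\mathrm{Tow}}|=|\det K_{n,p}|.$$ We also have that $$K_{n,p}^{-1}=\begin{pmatrix}(\tilde W_{n,p}^{\mathrm{Tow}})^{-1} & -(\tilde W_{n,p}^{\mathrm{Tow}})^{-1}B_{n,p}D_{n,p}^{-1}\\ -D_{n,p}^{-1}C_{n,p}(\tilde W_{n,p}^{\mathrm{Tow}})^{-1} & D_{n,p}^{-1}+D_{n,p}^{-1}C_{n,p}(\tilde W_{n,p}^{\mathrm{Tow}})^{-1}B_{n,p}D_{n,p}^{-1}\end{pmatrix}.$$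
   Context: Tower Aztec diamond of size $n$ with corridor of size $p$: white vertices $\mathtt W=\{(2j+1,2k):0\le j\le n-1,\ -p-n+1\le k\le n\}$; black vertices $\mathtt B$ are the points $(2j,2k+1)$ with either $0\le j\le n,\ 0\le k\le n-1$, or $0\le j\le n-1,\ -p\le k\le -1$, or $1\le j\le n-1,\ -p-n\le k\le -1-p$. A black and a white vertex are joined by an edge iff they differ by $(\pm1,\pm1)$. Edge weights: for a black vertex $x=(2r,2s+1)$ and a white neighbour $y$, the weight of the edge is $1$ if $y-x=(-1,-1)$ or $y-x=(-1,1)$, it is $a_{r,s}$ if $y-x=(1,1)$, and $b_{r,s}$ if $y-x=(1,-1)$. Kasteleyn matrix $K_{n,p}^{\mathrm{Tow}}:\mathtt B\times\mathtt W\to\mathbb C$: for $x=(2r,2s+1)\in\mathtt B$, $y\in\mathtt W$, $K_{n,p}^{\mathrm{Tow}}(x,y)$ equals $1$ if $y-x=(-1,-1)$, $\mathrm i$ if $y-x=(-1,1)$, $a_{r,s}$ if $y-x=(1,1)$, $\mathrm i\,b_{r,s}$ if $y-x=(1,-1)$, and $0$ otherwise. Ordering (with $[i]_m=i\bmod m\in\{0,\dots,m-1\}$), for $1\le i\le n(2n+p)$: $w(i)=(2n-1,2-2i)$ for $1\le i\le n+p$; $w(i)=\big(2[i-(n+p+1)]_n+1,\ 2n-2\lfloor\frac{i-(n+p+1)}{n}\rfloor\big)$ for $n+p+1\le i\le n^2+2n+p-1$; $w(i)=\big(2[i-(n^2+2n+p)]_{n-1}+1,\ -2-2\lfloor\frac{i-(n^2+2n+p)}{n-1}\rfloor\big)$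 otherwise. $b(i)=(0,2n+1-2i)$ for $1\le i\le n+p$; $b(i)=\big(2[i-(n+p+1)]_n+2,\ 2n-1-2\lfloor\frac{i-(n+p+1)}{n}\rfloor\big)$ for $n+p+1\le i\le n^2+n+p$; $b(i)=\big(2[i-(n^2+n+p+1)]_{n-1}+2,\ -1-2\lfloor\frac{i-(n^2+n+p+1)}{n-1}\rfloor\big)$ otherwise. The ordered Kasteleyn matrix is $K_{n,p}=(K_{n,p}^{\mathrm{Tow}}(b(i),w(j)))_{1\le i,j\le n(2n+p)}$. For a matrix $M$, $M[i;j,k;l]$ denotes the submatrix with rows $i$ through $j$ and columns $k$ through $l$. DR graph of the tower Aztec diamond: its vertices are the points $(2j,2k-1)$ with either $0\le j\le n,\ -p\le k\le n$, or $1\le j\le n,\ -p-n+1\le k\le -p-1$. Its directed edges are: horizontal edges $((2j,2k-1),(2j+2,2k-1))$ for $0\le j\le n-1,\ -p\le k\le n$ and for $1\le j\le n-1,\ -n-p+1\le k\le -p-1$; vertical edges $((2j,2k-1),(2j,2k-3))$ for $0\le j\le n,\ -p+1\le k\le n$ and for $1\le j\le n,\ -n-p+2\le k\le -p$; diagonal edges $((2j,2k-1),(2j+2,2k-3))$ for $0\le j\le n-1,\ -p+1\le k\le n$ and for $1\le j\le n-1,\ -n-p+2\le k\le -p$. The dimer weights transfer to these edges: the horizontal edge starting at $(2r,2s+1)$ has weight $a_{r,s}$, the diagonal edge starting at $(2r,2s+1)$ has weight $b_{r,s}$, and vertical edges have weight $1$. The weight of a path is the product of the weights of its edges. The LGV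 matrix for the tower Aztec diamond is the $(n+p)\times(n+p)$ matrix whose $(i,j)$ entry is the weighted number (sum of the weights) of directed paths in the DR graph from $(0,2n+1-2i)$ to $(2n,1-2j)$. ''Up to sign'' is meant entrywise, where a sign may be any of $\pm1,\pm\mathrm i$.
   Formalization: n=1 is excluded (W̃ is singular there), and LGV paths use only DR edges standing for a dimer: vertical edges on x=0, vertical edges on x=2n starting at height 2k-1 with k≤0, and the horizontal edge from (0,-2p-1) are dropped, since with them the entries differ. *)

(* Defs.v *)
From mathcomp Require Import all_boot all_order all_algebra.
From mathcomp Require Import complex.
From mathcomp Require Import classical_sets fsbigop reals.

Set Implicit Arguments.
Unset Strict Implicit.
Unset Printing Implicit Defensive.

Import Order.TTheory GRing.Theory Num.Theory.

Local Open Scope classical_set_scope.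
Local Open Scope complex_scope.
Local Open Scope ring_scope.

Definition point := (int * int)%type.

(* %/ is the floor division of intdiv, so a point (2r, 2s+1) or (2r+1, 2s) has
   (halfx, halfy) = (r, s), for negative coordinates too. *)
Definition halfx (x : point) : int := (x.1 %/ 2)%Z.
Definition halfy (x : point) : int := (x.2 %/ 2)%Z.

Definition white (n p : nat) (x : point) : bool :=
  let j := halfx x in let k := halfy x in
  [&& x == (2 * j + 1, 2 * k),
      0 <= j <= n%:Z - 1 & - p%:Z - n%:Z + 1 <= k <= n%:Z].

Definition black (n p : nat) (x : point) : bool :=
  let j := halfx x in let k := halfy x in
  (x == (2 * j, 2 * k + 1)) &&
  [|| (0 <= j <= n%:Z) && (0 <= k <= n%:Z - 1),
      (0 <= j <= n%:Z - 1) && (- p%:Z <= k <= -1)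
    | (1 <= j <= n%:Z - 1) && (- p%:Z - n%:Z <= k <= -1 - p%:Z)].

Definition tower_edge (n p : nat) (x y : point) : bool :=
  [&& black n p x, white n p y &
      y - x \in ([:: (-1, -1); (-1, 1); (1, 1); (1, -1)] : seq point)].

(* Meant for x black and y white; the matrix below only evaluates it there. *)
Definition kasteleyn (R : realType) (a b : int -> int -> R) (x y : point)
    : R[i] :=
  let r := halfx x in let s := halfy x in
  if y - x == (-1, -1) then 1
  else if y - x == (-1, 1) then 'i%C
  else if y - x == (1, 1) then (a r s)%:C
  else if y - x == (1, -1) then 'i%C * (b r s)%:C
  else 0.

(* The enumerations w(i) and b(i), with i starting from 1. *)
Definition wvert (n p i : nat) : point :=
  if (i <= n + p)%N then (2 * n%:Z - 1, 2 - 2 * i%:Z)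
  else if (i <= n ^ 2 + 2 * n + p - 1)%N then
    let m := (i - (n + p + 1))%N in
    (2 * (m %% n)%N%:Z + 1, 2 * n%:Z - 2 * (m %/ n)%N%:Z)
  else
    let m := (i - (n ^ 2 + 2 * n + p))%N in
    (2 * (m %% (n - 1))%N%:Z + 1, - 2 - 2 * (m %/ (n - 1))%N%:Z).

Definition bvert (n p i : nat) : point :=
  if (i <= n + p)%N then (0, 2 * n%:Z + 1 - 2 * i%:Z)
  else if (i <= n ^ 2 + n + p)%N then
    let m := (i - (n + p + 1))%N in
    (2 * (m %% n)%N%:Z + 2, 2 * n%:Z - 1 - 2 * (m %/ n)%N%:Z)
  else
    let m := (i - (n ^ 2 + n + p + 1))%N in
    (2 * (m %% (n - 1))%N%:Z + 2, - 1 - 2 * (m %/ (n - 1))%N%:Z).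

Definition tower_size (n p : nat) : nat := (n * (2 * n + p))%N.
Definition tail_size (n p : nat) : nat := (tower_size n p - (n + p))%N.

Definition kasteleyn_mx (R : realType) (n p : nat) (a b : int -> int -> R)
    : 'M[R[i]]_(tower_size n p) :=
  \matrix_(i, j) kasteleyn a b (bvert n p i.+1) (wvert n p j.+1).

Lemma tower_size_split (n p : nat) :
  (0 < n)%N -> tower_size n p = (n + p + tail_size n p)%N.
Proof.
case: n => // n _; rewrite /tail_size subnKC // /tower_size mulnDr leq_add //; last exact: leq_pmull.
by rewrite mulnA leq_pmull // muln_gt0.
Qed.

(* A square matrix of size n(2n+p), its rows and columns being cut into the
   first n+p ones and the others. *)
Definition tower_split (R : realType) (n p : nat) (n_gt0 : (0 < n)%N)
    (M : 'M[R[i]]_(tower_size n p)) : 'M[R[i]]_(n + p + tail_size n p) :=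
  castmx (tower_size_split p n_gt0, tower_size_split p n_gt0) M.

(* The DR graph; a vertex (2j, 2k-1) has (drj, drk) = (j, k). *)
Definition drj (x : point) : int := (x.1 %/ 2)%Z.
Definition drk (x : point) : int := ((x.2 + 1) %/ 2)%Z.

Definition dr_vertex (n p : nat) (x : point) : bool :=
  let j := drj x in let k := drk x in
  (x == (2 * j, 2 * k - 1)) &&
  ((0 <= j <= n%:Z) && (- p%:Z <= k <= n%:Z)
   || (1 <= j <= n%:Z) && (- p%:Z - n%:Z + 1 <= k <= - p%:Z - 1)).

Definition dr_horizontal (n p : nat) (x y : point) : bool :=
  let j := drj x in let k := drk x in
  (y - x == (2, 0)) &&
  ((0 <= j <= n%:Z - 1) && (- p%:Z <= k <= n%:Z)
   || (1 <= j <= n%:Z - 1) && (- n%:Z - p%:Z + 1 <= k <= - p%:Z - 1)).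

Definition dr_vertical (n p : nat) (x y : point) : bool :=
  let j := drj x in let k := drk x in
  (y - x == (0, -2)) &&
  ((0 <= j <= n%:Z) && (- p%:Z + 1 <= k <= n%:Z)
   || (1 <= j <= n%:Z) && (- n%:Z - p%:Z + 2 <= k <= - p%:Z)).

Definition dr_diagonal (n p : nat) (x y : point) : bool :=
  let j := drj x in let k := drk x in
  (y - x == (2, -2)) &&
  ((0 <= j <= n%:Z - 1) && (- p%:Z + 1 <= k <= n%:Z)
   || (1 <= j <= n%:Z - 1) && (- n%:Z - p%:Z + 2 <= k <= - p%:Z)).

Definition dr_edge (n p : nat) (x y : point) : bool :=
  [&& dr_vertex n p x, dr_vertex n p y &
      [|| dr_horizontal n p x y, dr_vertical n p x y | dr_diagonal n p x y]].

(* The white end of the dimer which an edge of the DR graph from x to y stands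
   for; the black end is x. *)
Definition dr_dimer (x y : point) : point :=
  if y - x == (2, 0) then x + (1, 1)
  else if y - x == (2, -2) then x + (1, -1)
  else x + (-1, -1).

(* Some boundary edges of the DR graph stand for no dimer: the vertical ones
   with j = 0 (no white vertex has abscissa -1), the vertical ones with j = n
   and k <= 0, and the edge from (0, -2p-1) to (2, -2p-1) (their starting points
   are not black). No dimer weight transfers to these edges, and counting paths
   through them would change the entries of the LGV matrix, and even its
   determinant. They are left out. *)
Definition dr_step (n p : nat) (x y : point) : bool :=
  dr_edge n p x y && tower_edge n p x (dr_dimer x y).

Definition dr_weight (R : realType) (a b : int -> int -> R) (x y : point) : R :=
  let r := halfx x in let s := halfy x in
  if y - x == (2, 0) then a r s
  else if y - x == (2, -2) then b r s
  else 1.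

(* A directed path is represented by its starting point u and the sequence q of
   its further vertices. *)
Definition dr_paths (n p : nat) (u v : point) : set (seq point) :=
  [set q | path (dr_step n p) u q /\ last u q = v].

Definition path_weight (R : realType) (a b : int -> int -> R)
    (u : point) (q : seq point) : R :=
  \prod_(c <- pairmap (dr_weight a b) u q) c.

(* Steps lower x.2 - x.1, so the paths below are finite in number and \sum is
   the ordinary finite sum. *)
Definition lgv_mx (R : realType) (n p : nat) (a b : int -> int -> R)
    : 'M[R]_(n + p) :=
  \matrix_(i, j)
    let u : point := (0, 2 * n%:Z + 1 - 2 * i.+1%:Z) in
    let v : point := (2 * n%:Z, 1 - 2 * j.+1%:Z) in
    \sum_(q \in dr_paths n p u v) path_weight a b u q.

(* Main.v *)
From mathcomp Require Import all_boot all_order all_algebra.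
From mathcomp Require Import complex reals.
From mathcomp Require Import classical_sets fsbigop.
From mathcomp Require Import ring lra zify.
Require Import Defs.

Set Implicit Arguments.
Unset Strict Implicit.
Unset Printing Implicit Defensive.

Import Order.TTheory GRing.Theory Num.Theory.

Local Open Scope complex_scope.
Local Open Scope ring_scope.

(** In the block form of K the upper left block vanishes, since the two sides
    x = 0 and x = 2n-1 which index it are not adjacent, and D is upper triangular
    with all diagonal entries equal to i, since the tail orderings pair each
    black vertex with the white vertex at its upper left. So |det D| = 1, W is
    the Schur complement of D, and block algebra gives the formula for det K
    (det_schur) and, once W is known to be invertible, the one for the inverse of
    K (invmx_schur).

    W and the path counts. Multiplying K on both sides by diagonal matrices of powers
    of i turns it into a real matrix whose entry is 1 for the edge (-1,1) and minus the
    dimer weight for the three other ones (kasteleyn_gauge). These three edges,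
    each followed by the step (1,-1), are the three steps of the DR graph. Hence,
    for an endpoint v, row x of the real matrix applied to the vector
    y |-> (weighted number of paths from y + (1,-1) to v) compares the path count
    at x with its first-step decomposition (path_sum_rec), and the outcome is 0 in
    the tail rows, and minus the path count in the rows x = 0, which lack the
    edge (-1,1) (real_kasteleyn_path_sum). On the first n+p columns, where
    y + (1,-1) is itself an endpoint, these vectors form the identity matrix, so
    that their other entries form, up to the gauge, the matrix -D^-1 C, and their
    images give W = - B D^-1 C (schur_lgv).

    Invertibility of K. A kernel vector of the real matrix, read along the columns
    j = 0, ..., n-1 of white vertices, is a family of real sequences u_j with
      u_j(t) - u_j(t-1) = a u_{j+1}(t) + b u_{j+1}(t-1),
    where u_0 alternates in sign along its upper part and u_{n-1} is constant
    along its upper part. By Rolle's argument on the left (le_changes_diff) and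
    positivity of the weights on the right (le_changes_smooth), the number of sign
    changes of u_j does not decrease with j. Comparing the two ends, the upper
    parts of all the columns vanish (top_columns_eq0); then the inequality between
    consecutive columns becomes strict, and the rest vanishes as well
    (columns_eq0). *)

(** * Sign changes of a real sequence *)

Section SignChanges.
Variable R : realFieldType.
Implicit Types u g h : nat -> R.

Definition prev u t : R := if t is t'.+1 then u t' else 0.

(** The two components are the numbers of sign changes of the list
    u 0, ..., u (t-1), zeros being skipped, once a positive, respectively a
    negative, entry is appended to it. Unlike the plain number of sign changes,
    this pair determines its own next value from the sign of the next entry, and
    comparing two pairs componentwise also compares the last signs of the two
    lists when the plain numbers agree. *)
Fixpoint changes u t : nat * nat :=
  if t is t'.+1 then
    let c := changes u t' in
    if 0 < u t' then (c.1, c.1.+1) else if u t' < 0 then (c.2.+1, c.2) else c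
  else (0, 0)%N.

Definition max_changes u t := maxn (changes u t).1 (changes u t).2.

Definition le_changes u v t :=
  ((changes u t).1 <= (changes v t).1)%N /\ ((changes u t).2 <= (changes v t).2)%N.

Variant changes_spec u t : nat * nat -> Type :=
| ChangesPos of 0 < u t : changes_spec u t ((changes u t).1, (changes u t).1.+1)
| ChangesNeg of u t < 0 : changes_spec u t ((changes u t).2.+1, (changes u t).2)
| ChangesZero of u t = 0 : changes_spec u t (changes u t).

Lemma changesP u t : changes_spec u t (changes u t.+1).
Proof.
by rewrite [changes u t.+1]/=; case: (ltrgtP 0 (u t)) => u0; constructor.
Qed.

Lemma changes_prev_pos u t : 0 < prev u t -> (changes u t).2 = (changes u t).1.+1.
Proof.
case: t => [|t]; rewrite [prev _ _]/= ?ltxx //.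
by case: changesP => // [/lt_gtF->|->] //; rewrite ltxx.
Qed.

Lemma changes_prev_neg u t : prev u t < 0 -> (changes u t).1 = (changes u t).2.+1.
Proof.
case: t => [|t]; rewrite [prev _ _]/= ?ltxx //.
by case: changesP => // [/lt_gtF->|->] //; rewrite ltxx.
Qed.

Lemma max_changes_leq u t : (max_changes u t <= t)%N.
Proof.
elim: t => // t; rewrite /max_changes.
case: (changesP u t) => _ /=; lia.
Qed.

(** A discrete Rolle theorem: between two entries of opposite signs a sequence
    must move in the direction of the second one. *)
Lemma le_changes_diff g h T :
  (forall t, (t < T)%N -> g t - prev g t = h t) -> le_changes g h T.
Proof.
rewrite /le_changes; elim: T => // t IH gh.
have [|IH1 IH2] := IH; first by move=> s st; apply: gh; rewrite ltnS ltnW.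
have pos := @changes_prev_pos g t; have neg := @changes_prev_neg g t.
have {IH gh} e := gh t (leqnn _).
(* When the new signs of g and h differ, the equation forces the sign of the
   previous entry of g, hence an order between the two components of g. *)
case: (changesP h t) => h0; case: (changesP g t) => g0 /=;
  first [ (have p0 : 0 < prev g t by lra); have := pos p0; clear -IH1 IH2; lia
        | (have p0 : prev g t < 0 by lra); have := neg p0; clear -IH1 IH2; lia
        | clear -IH1 IH2; lia].
Qed.

(** Averaging neighbours with positive weights creates no sign change: an
    average has the sign of one of its two terms. *)
Lemma le_changes_smooth h g (a b : nat -> R) T :
  (forall t, 0 < a t) -> (forall t, 0 < b t) ->
  (forall t, (t < T)%N -> h t = a t * g t + b t * prev g t) -> le_changes h g T.
Proof.
rewrite /le_changes => a0 b0; elim: T => // t IH gh.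
have [|IH1 IH2] := IH; first by move=> s st; apply: gh; rewrite ltnS ltnW.
have pos := @changes_prev_pos g t; have neg := @changes_prev_neg g t.
have {IH gh} e := gh t (leqnn _); have {}a0 := a0 t; have {}b0 := b0 t.
case: (changesP h t) => h0; case: (changesP g t) => g0 /=;
  first [ (have p0 : 0 < prev g t by nra); have := pos p0; clear -IH1 IH2; lia
        | (have p0 : prev g t < 0 by nra); have := neg p0; clear -IH1 IH2; lia
        | clear -IH1 IH2; lia].
Qed.

Lemma alternating_sign (v a b : nat -> R) s :
  0 < a s -> 0 < b s -> a s * v s + b s * prev v s = 0 ->
  [/\ 0 < v s -> prev v s < 0, v s < 0 -> 0 < prev v s & v s = 0 -> prev v s = 0].
Proof.
move=> as0 bs0 e; split=> vs.
- by rewrite -(pmulr_rlt0 _ bs0); have := mulr_gt0 as0 vs; lra.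
- by rewrite -(pmulr_rgt0 _ bs0); have := nmulr_llt0 (a s) vs; lra.
- by move: e; rewrite vs mulr0 add0r => /eqP; rewrite mulf_eq0 gt_eqF // => /eqP.
Qed.

Lemma alternating_max_changes (v a b : nat -> R) m T :
  (forall t, 0 < a t) -> (forall t, 0 < b t) ->
  (forall s, (m < s < T)%N -> a s * v s + b s * prev v s = 0) ->
  v m != 0 -> (m < T)%N -> (T - m <= max_changes v T)%N.
Proof.
move=> a0 b0 alt vm0 mT.
have : forall k, (m + k < T)%N ->
    v (m + k)%N != 0 /\ (k < max_changes v (m + k).+1)%N.
  elim=> [|k IH] kT.
    rewrite addn0; split=> //; rewrite /max_changes.
    by case: changesP => v0 /=; [lia | lia | rewrite v0 eqxx in vm0].
  have [vk] := IH (ltac:(lia) : (m + k < T)%N); rewrite addnS /max_changes.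
  have [pos neg zero] := alternating_sign (a0 _) (b0 _) (alt (m + k).+1 ltac:(lia)).
  have pos' := @changes_prev_pos v (m + k).+1.
  have neg' := @changes_prev_neg v (m + k).+1.
  have zero' vk1 : v (m + k)%N = 0 := zero vk1.
  move: pos' neg'; case: (changesP v (m + k).+1) => vk1.
  - move=> _ /(_ (pos vk1)) ck maxk; split; first by rewrite gt_eqF.
    by move: maxk ck; move: (changes v (m + k).+1) => c /=; clear; lia.
  - move=> /(_ (neg vk1)) ck _ maxk; split; first by rewrite lt_eqF.
    by move: maxk ck; move: (changes v (m + k).+1) => c /=; clear; lia.
  - by rewrite zero' ?eqxx in vk.
move=> /(_ (T - m).-1 ltac:(lia))[_].
rewrite (_ : (m + (T - m).-1).+1 = T); last by lia.
by rewrite prednK // subn_gt0.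
Qed.

End SignChanges.

(** * Uniqueness for the boundary value problem on columns *)

Section Columns.
Variables (R : realFieldType) (n p : nat) (u a b : nat -> nat -> R).
Let M := (2 * n + p)%N.
Hypothesis n_gt0 : (0 < n)%N.
Hypothesis a_gt0 : forall j t, 0 < a j t.
Hypothesis b_gt0 : forall j t, 0 < b j t.
Hypothesis first_column : forall t, (n <= t < M)%N ->
  a 0%N t * u 0%N t + b 0%N t * prev (u 0%N) t = 0.
Hypothesis inner_column : forall j t, (j.+1 < n)%N -> (t < M)%N ->
  u j t - prev (u j) t = a j.+1 t * u j.+1 t + b j.+1 t * prev (u j.+1) t.
Hypothesis last_column : forall t, (n + p <= t < M)%N ->
  u n.-1 t = prev (u n.-1) t.

Lemma le_changes_columns T i j :
  (T <= M)%N -> (i <= j < n)%N -> le_changes (u i) (u j) T.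
Proof.
move=> TM; elim: j => [|j IH]; first by rewrite leqn0 => /andP[/eqP->]; split.
case/andP; rewrite leq_eqVlt => /predU1P[-> _|ij jn]; first by split.
have [h1 h2] := IH (introT andP (conj ij (ltnW jn))).
pose h t := u j t - prev (u j) t.
have [g1 g2] : le_changes (u j) h T by apply: le_changes_diff.
have [k1 k2] : le_changes h (u j.+1) T.
  apply: (@le_changes_smooth _ _ _ (a j.+1) (b j.+1)) => // t tT.
  by apply: inner_column => //; apply: leq_trans TM.
by split; lia.
Qed.

(** The last column is constant along its top n+1 entries. *)
Lemma max_changes_last_column : (max_changes (u n.-1) M <= n + p)%N.
Proof.
have : forall k, (k <= n)%N -> (max_changes (u n.-1) (n + p + k) <= n + p)%N.
  elim=> [|k IH] kn; first by rewrite addn0 max_changes_leq.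
  have := IH (ltnW kn); rewrite addnS /max_changes.
  have := last_column (ltac:(lia) : (n + p <= n + p + k < M)%N).
  have := @changes_prev_pos _ (u n.-1) (n + p + k).
  have := @changes_prev_neg _ (u n.-1) (n + p + k).
  move=> neg pos e.
  case: changesP => [/[!e] /pos|/[!e] /neg|_] /=; clear; lia.
by move=> /(_ n (leqnn _)); rewrite -/M (_ : n + p + n = M)%N // /M; lia.
Qed.

(** Column 0 alternates along its top n+p+1 entries, and so does column j+1 once
    column j vanishes there. If they did not vanish, these entries would have
    more sign changes than the last column, and columns cannot lose any. *)
Lemma top_columns_eq0 j t : (j < n)%N -> (n.-1 <= t < M)%N -> u j t = 0.
Proof.
move=> jn; have [m] := ubnP j; elim: m j jn t => // m IH j jn t jm.
have alt s : (n.-1 < s < M)%N -> a j s * u j s + b j s * prev (u j) s = 0.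
  case: j {t} jn jm => [|j] jn jm sM; first by apply: first_column; lia.
  rewrite -inner_column //; last by case/andP: sM.
  have z q : (n.-1 <= q < M)%N -> u j q = 0 by apply: IH => //; exact: ltnW.
  case: s sM => [|s] sM; first by clear -sM n_gt0; lia.
  by rewrite /= !z ?subrr //; clear -sM n_gt0; lia.
have bottom0 : u j n.-1 = 0.
  apply/eqP; case: eqP => // /eqP un0.
  have := alternating_max_changes (a_gt0 j) (b_gt0 j) alt un0 ltac:(lia).
  have [] := @le_changes_columns M j n.-1 (leqnn _) ltac:(lia).
  by have := max_changes_last_column; rewrite /max_changes /M; lia.
elim: t => [|t IHt]; first by case: n.-1 bottom0.
case/andP; rewrite leq_eqVlt => /predU1P[<- //|nt tM].
have [pos neg _] := alternating_sign (a_gt0 j _) (b_gt0 j _) (alt t.+1 ltac:(lia)).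
have ut : u j t = 0 by apply: IHt; lia.
move: pos neg; rewrite /= ut ltxx => pos neg.
by case: (ltrgtP (u j t.+1) 0) => [/neg|/pos|].
Qed.

(** When q is the highest nonzero position of column i, the difference at q+1
    has the sign opposite to u i q: it is a sign change that column i lacks and
    column i+1 inherits. *)
Lemma max_changes_gain i q : (i.+1 < n)%N -> (q.+1 < M)%N ->
  u i q.+1 = 0 -> u i.+1 q.+1 = 0 -> u i q != 0 ->
  u i.+1 q != 0 /\ (max_changes (u i) q.+1 < max_changes (u i.+1) q.+1)%N.
Proof.
move=> iN qM ui ui1 uiq.
pose h t := u i t - prev (u i) t.
have hq : h q.+1 = - u i q by rewrite /h /= ui sub0r.
have flip : - u i q = b i.+1 q.+1 * u i.+1 q.
  by rewrite -hq /h inner_column // ui1 mulr0 add0r.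
have bpos := b_gt0 i.+1 q.+1.
have [g1 g2] : le_changes (u i) h q.+1 by apply: le_changes_diff.
have [k1 k2] : le_changes h (u i.+1) q.+2.
  apply: (@le_changes_smooth _ _ _ (a i.+1) (b i.+1)) => // t tq.
  by apply: inner_column => //; apply: leq_trans tq qM.
have cu : changes (u i.+1) q.+2 = changes (u i.+1) q.+1.
  by case: changesP => //; rewrite ui1 ltxx.
rewrite cu in k1 k2.
have pos := @changes_prev_pos _ (u i) q.+1.
have neg := @changes_prev_neg _ (u i) q.+1.
have pos1 := @changes_prev_pos _ (u i.+1) q.+1.
have neg1 := @changes_prev_neg _ (u i.+1) q.+1.
rewrite /= in pos neg pos1 neg1.
rewrite /max_changes; case/lt_total/orP: uiq => uiq.
- have uj1 : 0 < u i.+1 q by rewrite -(pmulr_rgt0 _ bpos) -flip oppr_gt0.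
  have := neg uiq; have := pos1 uj1.
  have hp : 0 < h q.+1 by rewrite hq oppr_gt0.
  move: k1 k2 g1 g2; case: (changesP h q.+1) => h0; [|exfalso; lra..].
  move=> k1 k2 g1 g2 e1 e2; split; first by rewrite gt_eqF.
  by move: k1 k2 g1 g2 e1 e2 => /=; clear; lia.
- have uj1 : u i.+1 q < 0 by rewrite -(pmulr_rlt0 _ bpos) -flip oppr_lt0.
  have := pos uiq; have := neg1 uj1.
  have hp : h q.+1 < 0 by rewrite hq oppr_lt0.
  move: k1 k2 g1 g2; case: (changesP h q.+1) => h0; [exfalso; lra| |exfalso; lra].
  move=> k1 k2 g1 g2 e1 e2; split; first by rewrite lt_eqF.
  by move: k1 k2 g1 g2 e1 e2 => /=; clear; lia.
Qed.

(** The remaining entries vanish row by row, from the top: along a nonzero row q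
    below row n-1, each of the n columns would gain a sign change on the
    preceding one, which does not fit into the q+1 entries left. *)
Lemma columns_eq0 j t : (j < n)%N -> (t < M)%N -> u j t = 0.
Proof.
suff low r : (r < n)%N ->
    forall j t, (j < n)%N -> (n.-1 - r <= t < M)%N -> u j t = 0.
  by move=> jn tM; apply: (low n.-1) => //; lia.
elim: r {j t} => [|r IH] rn.
  by move=> j t; rewrite subn0; apply: top_columns_eq0.
pose q := (n.-1 - r.+1)%N.
have zero j t : (j < n)%N -> (q < t < M)%N -> u j t = 0.
  by move=> jn qt; apply: IH => //; rewrite /q in qt *; lia.
have qM : (q < q.+1 < M)%N by rewrite /M /q; lia.
have /andP[_ qM1] := qM.
have first0 : u 0%N q = 0.
  apply/eqP; case: eqP => // /eqP un0.
  have : forall j, (j < n)%N -> u j q != 0 /\ (j < max_changes (u j) q.+1)%N.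
    elim=> [|i IHi] iN.
      split=> //; rewrite /max_changes; case: changesP => u0 /=; [lia | lia |].
      by rewrite u0 eqxx in un0.
    have [uiq imax] := IHi (ltnW iN).
    have ui := zero i q.+1 (ltnW iN) qM; have ui1 := zero i.+1 q.+1 iN qM.
    have [? gain] := max_changes_gain iN qM1 ui ui1 uiq.
    by split=> //; apply: leq_ltn_trans gain.
  move=> /(_ n.-1 ltac:(lia))[_]; rewrite -ltnS => lt.
  have := max_changes_leq (u n.-1) q.+1; rewrite /q in lt *; lia.
move=> j t jn; case/andP; rewrite leq_eqVlt.
case/predU1P=> [<- _|qt tM]; last by apply: zero; rewrite ?qt.
rewrite -/q; elim: j jn => // j IHj jn.
have := @inner_column j q.+1 jn qM1.
rewrite /= (zero j q.+1) ?(zero j.+1 q.+1) ?(ltnW jn) // IHj ?(ltnW jn) //.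
by rewrite subr0 mulr0 add0r => /esym/eqP; rewrite mulf_eq0 gt_eqF // => /eqP.
Qed.

End Columns.

(** * Vertices and their enumerations *)

Lemma pairD (x1 x2 y1 y2 : int) : (x1, x2) + (y1, y2) = (x1 + y1, x2 + y2).
Proof. by []. Qed.

Lemma pairB (x1 x2 y1 y2 : int) : (x1, x2) - (y1, y2) = (x1 - y1, x2 - y2).
Proof. by []. Qed.

Lemma half_double (z : int) : ((2 * z) %/ 2)%Z = z.
Proof. by lia. Qed.

Lemma half_double1 (z : int) : ((2 * z + 1) %/ 2)%Z = z.
Proof. by lia. Qed.

Lemma whiteE n p (j k : int) : white n p (2 * j + 1, 2 * k) =
  (0 <= j <= n%:Z - 1) && (- p%:Z - n%:Z + 1 <= k <= n%:Z).
Proof. by rewrite /white /halfx /halfy /= half_double half_double1 eqxx. Qed.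

Lemma blackE n p (j k : int) : black n p (2 * j, 2 * k + 1) =
  [|| (0 <= j <= n%:Z) && (0 <= k <= n%:Z - 1),
      (0 <= j <= n%:Z - 1) && (- p%:Z <= k <= -1)
    | (1 <= j <= n%:Z - 1) && (- p%:Z - n%:Z <= k <= -1 - p%:Z)].
Proof. by rewrite /black /halfx /halfy /= half_double half_double1 eqxx. Qed.

Lemma white_coord n p y : white n p y -> exists j k : int,
  [/\ y = (2 * j + 1, 2 * k), 0 <= j <= n%:Z - 1 & - p%:Z - n%:Z + 1 <= k <= n%:Z].
Proof. by case/and3P => /eqP yE jn kn; exists (halfx y), (halfy y). Qed.

Lemma black_coord n p x : black n p x -> exists r s : int,
  [/\ x = (2 * r, 2 * s + 1), 0 <= r <= n%:Z & - p%:Z - n%:Z <= s <= n%:Z - 1].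
Proof. by case/andP=> /eqP xE bl; exists (halfx x), (halfy x); split=> //; lia. Qed.

Section Enumerations.
Variables n p : nat.
Hypothesis n_gt1 : (1 < n)%N.

Let N := tower_size n p.

Lemma wvert_head i : (i < n + p)%N -> wvert n p i.+1 = (2 * n%:Z - 1, - 2 * i%:Z).
Proof. by rewrite /wvert => ->; congr pair; lia. Qed.

Lemma bvert_head i : (i < n + p)%N -> bvert n p i.+1 = (0, 2 * n%:Z - 1 - 2 * i%:Z).
Proof. by rewrite /bvert => ->; congr pair; lia. Qed.

Lemma wvert_upper q r : (r < n)%N -> (q * n + r < n * n + n.-1)%N ->
  wvert n p (n + p + (q * n + r)).+1 = (2 * r%:Z + 1, 2 * n%:Z - 2 * q%:Z).
Proof.
move=> rn qr; rewrite /wvert -!mulnn ifF; last by lia.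
rewrite ifT; last by lia.
rewrite (_ : _.+1 - _ = q * n + r)%N; last by lia.
by rewrite modnMDl modn_small // divnMDl ?divn_small ?addn0 //; lia.
Qed.

Lemma wvert_lower q r : (r < n.-1)%N ->
  wvert n p (n + p + (n * n + n.-1 + (q * n.-1 + r))).+1 = (2 * r%:Z + 1, - 2 - 2 * q%:Z).
Proof.
move=> rn; rewrite /wvert -!mulnn ifF; last by lia.
rewrite ifF; last by lia.
rewrite (_ : (_.+1 - _ = q * n.-1 + r)%N); last by move: (q * n.-1)%N => z; nia.
by rewrite subn1 modnMDl modn_small // divnMDl ?divn_small ?addn0 //; lia.
Qed.

Lemma bvert_upper q r : (r < n)%N -> (q < n)%N ->
  bvert n p (n + p + (q * n + r)).+1 = (2 * r%:Z + 2, 2 * n%:Z - 1 - 2 * q%:Z).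
Proof.
move=> rn qn; rewrite /bvert -!mulnn ifF; last by lia.
rewrite ifT; last by nia.
rewrite (_ : (_.+1 - _ = q * n + r)%N); last by lia.
by rewrite modnMDl modn_small // divnMDl ?divn_small ?addn0 //; lia.
Qed.

Lemma bvert_lower q r : (r < n.-1)%N ->
  bvert n p (n + p + (n * n + (q * n.-1 + r))).+1 = (2 * r%:Z + 2, - 1 - 2 * q%:Z).
Proof.
move=> rn; rewrite /bvert -!mulnn ifF; last by lia.
rewrite ifF; last by lia.
rewrite (_ : (_.+1 - _ = q * n.-1 + r)%N); last by move: (q * n.-1)%N => z; nia.
by rewrite subn1 modnMDl modn_small // divnMDl ?divn_small ?addn0 //; lia.
Qed.

(** The tail enumerations read the points row by row from the top, q being the row
    and r the place in it. White rows have n points down to y = 2, the row y = 0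
    has lost its last point to the head, and the lower rows have n-1 points. *)
Variant wvert_spec i : point -> Type :=
| WHead of (i < n + p)%N : wvert_spec i (2 * n%:Z - 1, - 2 * i%:Z)
| WUpper q r of i = (n + p + (q * n + r))%N & (r < n)%N & (q <= n)%N & (q < n)%N || (r < n.-1)%N :
   wvert_spec i (2 * r%:Z + 1, 2 * n%:Z - 2 * q%:Z)
| WLower q r of i = (n + p + (n * n + n.-1 + (q * n.-1 + r)))%N & (r < n.-1)%N & (q < (n + p).-1)%N :
   wvert_spec i (2 * r%:Z + 1, - 2 - 2 * q%:Z).

Lemma wvertP i : (i < N)%N -> wvert_spec i (wvert n p i.+1).
Proof.
move=> iN; have [ih|it] := ltnP i (n + p).
  by rewrite wvert_head //; apply: WHead.
move: iN; rewrite -(subnKC it); move: (i - _)%N => {it}t tN.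
have [tu|tl] := ltnP t (n * n + n.-1).
  have rn : (t %% n < n)%N by rewrite ltn_mod; lia.
  have := divn_eq t n; move: (t %/ n)%N (t %% n)%N rn => q r rn E; subst t.
  by rewrite wvert_upper //; apply: (@WUpper _ q r) => //; nia.
move: tN; rewrite -(subnKC tl) /N /tower_size; move: (t - _)%N => {tl}s sN.
have rn : (s %% n.-1 < n.-1)%N by rewrite ltn_mod; lia.
have := divn_eq s n.-1; move: (s %/ _)%N (s %% _)%N rn => q r rn E; subst s.
rewrite wvert_lower //; apply: (@WLower _ q r) => //.
by move: sN rn; case: n n_gt1 => // m m1; rewrite [m.+1.-1]/=; nia.
Qed.

Variant bvert_spec i : point -> Type :=
| BHead of (i < n + p)%N : bvert_spec i (0, 2 * n%:Z - 1 - 2 * i%:Z)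
| BUpper q r of i = (n + p + (q * n + r))%N & (r < n)%N & (q < n)%N :
   bvert_spec i (2 * r%:Z + 2, 2 * n%:Z - 1 - 2 * q%:Z)
| BLower q r of i = (n + p + (n * n + (q * n.-1 + r)))%N & (r < n.-1)%N & (q < n + p)%N :
   bvert_spec i (2 * r%:Z + 2, - 1 - 2 * q%:Z).

Lemma bvertP i : (i < N)%N -> bvert_spec i (bvert n p i.+1).
Proof.
move=> iN; have [ih|it] := ltnP i (n + p).
  by rewrite bvert_head //; apply: BHead.
move: iN; rewrite -(subnKC it); move: (i - _)%N => {it}t tN.
have [tu|tl] := ltnP t (n * n).
  have rn : (t %% n < n)%N by rewrite ltn_mod; lia.
  have := divn_eq t n; move: (t %/ n)%N (t %% n)%N rn => q r rn E; subst t.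
  have qn : (q < n)%N by nia.
  by rewrite bvert_upper //; apply: (@BUpper _ q r).
move: tN; rewrite -(subnKC tl) /N /tower_size; move: (t - _)%N => {tl}s sN.
have rn : (s %% n.-1 < n.-1)%N by rewrite ltn_mod; lia.
have := divn_eq s n.-1; move: (s %/ _)%N (s %% _)%N rn => q r rn E; subst s.
rewrite bvert_lower //; apply: (@BLower _ q r) => //.
by move: sN rn; case: n n_gt1 => // m m1; rewrite [m.+1.-1]/=; nia.
Qed.

Lemma white_wvert i : (i < N)%N -> white n p (wvert n p i.+1).
Proof.
case/wvertP => [ih|q r _ rn qn _|q r _ rn qn].
- rewrite (_ : (_, _) = (2 * (n%:Z - 1) + 1, 2 * - i%:Z)); last by congr pair; lia.
  by rewrite whiteE; lia.
- rewrite (_ : (_, _) = (2 * r%:Z + 1, 2 * (n%:Z - q%:Z))); last by congr pair; lia.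
  by rewrite whiteE; lia.
- rewrite (_ : (_, _) = (2 * r%:Z + 1, 2 * (-1 - q%:Z))); last by congr pair; lia.
  by rewrite whiteE; lia.
Qed.

Lemma black_bvert i : (i < N)%N -> black n p (bvert n p i.+1).
Proof.
case/bvertP => [ih|q r _ rn qn|q r _ rn qn].
- rewrite (_ : (_, _) = (2 * 0, 2 * (n%:Z - 1 - i%:Z) + 1)); last by congr pair; lia.
  by rewrite blackE; lia.
- rewrite (_ : (_, _) = (2 * (r%:Z + 1), 2 * (n%:Z - 1 - q%:Z) + 1)); last by congr pair; lia.
  by rewrite blackE; lia.
- rewrite (_ : (_, _) = (2 * (r%:Z + 1), 2 * (-1 - q%:Z) + 1)); last by congr pair; lia.
  by rewrite blackE; lia.
Qed.

Lemma wvert_surj y : white n p y -> exists2 i, (i < N)%N & wvert n p i.+1 = y.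
Proof.
case/white_coord => [j [k [-> jn kn]]]; rewrite /N /tower_size.
have [r rE] : exists r : nat, j = r%:Z by exists (absz j%R); lia.
have [kpos|kneg] := leP 0 k.
  have [q qE] : exists q : nat, k = n%:Z - q%:Z by exists (absz (n%:Z - k)%R); lia.
  have [qr|qr] := boolP ((q < n)%N || (r < n.-1)%N).
    exists (n + p + (q * n + r))%N; first by nia.
    by rewrite wvert_upper ?rE ?qE; [congr pair; lia| lia | nia].
  exists 0%N; first by nia.
  by rewrite wvert_head; [congr pair; lia| lia].
have [r1|r1] := ltnP r n.-1.
  have [q qE] : exists q : nat, k = -1 - q%:Z by exists (absz (k + 1)%R); lia.
  exists (n + p + (n * n + n.-1 + (q * n.-1 + r)))%N.
    have : (q < (n + p).-1)%N by lia.
    by move: r1; clear -n_gt1; case: n n_gt1 => // m m1; rewrite [m.+1.-1]/=; nia.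
  by rewrite wvert_lower ?rE ?qE //; congr pair; lia.
have [q qE] : exists q : nat, k = - q%:Z by exists (absz k%R); lia.
exists q; first by nia.
by rewrite wvert_head; [congr pair; lia| lia].
Qed.

Lemma bvert_surj (j k : int) : black n p (2 * j, 2 * k + 1) ->
  exists2 i, (i < N)%N & bvert n p i.+1 = (2 * j, 2 * k + 1).
Proof.
rewrite blackE /N /tower_size => bl.
have [j0|j0] := eqVneq j 0.
  have [q qE] : exists q : nat, k = n%:Z - 1 - q%:Z by exists (absz (k + 1 - n%:Z)%R); lia.
  exists q; first by nia.
  by rewrite bvert_head; [congr pair; lia| lia].
have [r rE] : exists r : nat, j = r%:Z + 1 by exists (absz (j - 1)%R); lia.
have [kpos|kneg] := leP 0 k.
  have [q qE] : exists q : nat, k = n%:Z - 1 - q%:Z by exists (absz (k + 1 - n%:Z)%R); lia.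
  exists (n + p + (q * n + r))%N; first by nia.
  by rewrite bvert_upper ?rE ?qE; [congr pair; lia| lia | lia].
have [q qE] : exists q : nat, k = -1 - q%:Z by exists (absz (k + 1)%R); lia.
have r1 : (r < n.-1)%N by lia.
exists (n + p + (n * n + (q * n.-1 + r)))%N.
  have : (q < (n + p))%N by lia.
  by move: r1; clear -n_gt1; case: n n_gt1 => // m m1; rewrite [m.+1.-1]/=; nia.
by rewrite bvert_lower ?rE ?qE //; congr pair; lia.
Qed.

(** Corresponding white and black tail rows have the same length, n for the n
    highest ones and n-1 below: the white row y = 0 has lost a point to the head,
    just as the black row y = -1 stops at x = 2n-2. *)
Lemma wvert_tail i : (n + p <= i < N)%N -> wvert n p i.+1 = bvert n p i.+1 + (-1, 1).
Proof.
case/andP=> it iN; case: (bvertP iN) => [|q r iE rn qn|q r iE rn qn]; first by lia.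
- by rewrite iE wvert_upper //; [rewrite pairD; congr pair; lia| nia].
(* The first short black row faces the row y = 0, which belongs to the upper
   branch of the white enumeration. *)
- have [q0|q0] := posnP q.
    rewrite iE q0 (_ : n * n + (0 * n.-1 + r) = n * n + r)%N; last by lia.
    by rewrite wvert_upper; [rewrite pairD; congr pair; lia| lia| lia].
  rewrite iE (_ : n * n + (q * n.-1 + r) = n * n + n.-1 + (q.-1 * n.-1 + r))%N; last first.
    by case: q q0 {iE qn} => // q _; rewrite mulSn; move: (q * n.-1)%N => z; lia.
  by rewrite wvert_lower // pairD; congr pair; lia.
Qed.

Lemma wvert_tail_lex i i' : (n + p <= i)%N -> (i < i' < N)%N ->
  let y := wvert n p i.+1 in let y' := wvert n p i'.+1 in
  (y'.2 < y.2) || (y'.2 == y.2) && (y.1 < y'.1).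
Proof.
move=> it /andP[ii iN'] /=; have iN := ltn_trans ii iN'.
case: (wvertP iN) => [|q r iE rn qn u|q r iE rn qn]; first by lia.
  case: (wvertP iN') => [|q' r' iE' rn' qn' u'|q' r' iE' rn' qn']; [by lia| |by rewrite /=; lia].
  have : (q * n + r < q' * n + r')%N by lia.
  rewrite /=; have [qq|qq|->] := ltngtP q q'; [lia| |lia].
  by have : (q' * n + n <= q * n)%N; [rewrite -mulSnr leq_mul2r qq orbT|lia].
case: (wvertP iN') => [|q' r' iE' rn' qn' u'|q' r' iE' rn' qn']; [by lia| |].
  have le_qn x : (x <= n)%N -> (x * n <= n * n)%N by rewrite leq_mul2r orbC => ->.
  have : (q' * n + r' < n * n + n.-1)%N.
    by case/orP: u' => [/le_qn|r1]; [rewrite mulSn | have := le_qn _ qn']; lia.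
  by move: iE; move: (q * n.-1)%N => z; lia.
have : (q * n.-1 + r < q' * n.-1 + r')%N by lia.
rewrite /=; have [qq|qq|->] := ltngtP q q'; [lia| |lia].
by have : (q' * n.-1 + n.-1 <= q * n.-1)%N; [rewrite -mulSnr leq_mul2r qq orbT|lia].
Qed.

Lemma wvert_inj i i' : (i < N)%N -> (i' < N)%N -> wvert n p i.+1 = wvert n p i'.+1 -> i = i'.
Proof.
wlog ii : i i' / (i < i')%N => [H|] iN iN'.
  case: (ltngtP i i') => // ii e; first exact: H.
  by apply/esym/H.
have [ih|it] := ltnP i (n + p); last first.
  move=> e; have := wvert_tail_lex it (introT andP (conj ii iN')).
  by rewrite /= e !ltxx andbF.
have [ih'|it'] := ltnP i' (n + p).
  by rewrite !wvert_head // => -[]; lia.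
rewrite wvert_head //; case: (wvertP iN') => [|q r _ rn qn u|q r _ rn qn]; first by lia.
  by case; lia.
by case; lia.
Qed.

End Enumerations.

(** * Weighted numbers of paths *)

Section PathSums.
Variables (R : realType) (n p : nat) (a b : int -> int -> R) (v : point).

Definition path_sum x : R := \sum_(q \in dr_paths n p x v) path_weight a b x q.

Definition dr_successors (x : point) : seq point :=
  [seq y <- [:: x + (2, 0); x + (0, -2); x + (2, -2)] | dr_step n p x y].

Lemma dr_successorsP x y : (y \in dr_successors x) = dr_step n p x y.
Proof.
rewrite mem_filter andb_idr // => /andP[/and3P[_ _ st] _].
rewrite !inE -!(subr_eq0 y) !opprD !addrA !subr_eq0.
move: st; rewrite /dr_horizontal /dr_vertical /dr_diagonal.
by case/or3P => /andP[/eqP-> _]; rewrite eqxx ?orbT.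
Qed.

Lemma dr_step_measure x y : dr_step n p x y -> y.2 - y.1 + 2 <= x.2 - x.1.
Proof.
rewrite -dr_successorsP mem_filter => /andP[_]; rewrite !inE.
by case: x => x1 x2; case/or3P => /eqP -> /=; lia.
Qed.

Lemma dr_path_size x q : path (dr_step n p) x q ->
  (last x q).2 - (last x q).1 + 2 * (size q)%:Z <= x.2 - x.1.
Proof.
elim: q x => [|y q IH] x /=; first by rewrite mulr0 addr0.
by case/andP => /dr_step_measure xy /IH; lia.
Qed.

(** Every step lowers y - x, so that for large m no path from x to v is longer
    than m: the sum over the set of all paths becomes a sum over this
    duplicate-free list. *)
Fixpoint walks m x : seq (seq point) :=
  (if x == v then [:: [::]] else [::]) ++
  (if m is m'.+1 then [seq y :: q | y <- dr_successors x, q <- walks m' y] else [::]).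

Lemma walksP m x q : q \in walks m x =
  [&& path (dr_step n p) x q, last x q == v & (size q <= m)%N].
Proof.
elim: m x q => [|m IH] x q; rewrite /= ?cats0 ?mem_cat.
  by case: q => [|y q]; case: eqVneq; rewrite ?andbF //.
case: q => [|y q] /=.
  rewrite andbT (_ : [::] \in allpairs_dep _ _ _ = false) ?orbF; first by case: eqVneq.
  by apply/negbTE/allpairsPdep => -[? [? []]].
rewrite (_ : _ \in (if _ then _ else _) = false); last by case: eqVneq.
apply/allpairsPdep/idP => [[y' [q' [st qw [-> ->]]]] | /and3P[/andP[st pth] lst sz]].
  by rewrite dr_successorsP in st; rewrite IH in qw; rewrite st.
by exists y, q; rewrite dr_successorsP IH st pth lst.
Qed.

Lemma walks_uniq m x : uniq (walks m x).
Proof.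
elim: m x => [|m IH] x /=; first by case: eqVneq.
rewrite cat_uniq; apply/and3P; split; first by case: eqVneq.
  by apply/hasPn => q /allpairsPdep[y [q' [_ _ ->]]]; case: eqVneq.
apply: allpairs_uniq_dep => //.
  by case: x => x1 x2; rewrite filter_uniq // !pairD /= !inE !xpair_eqE; lia.
by move=> [y q] [y' q'] _ _ /= [-> ->].
Qed.

Lemma path_weight_cons x y q :
  path_weight a b x (y :: q) = dr_weight a b x y * path_weight a b y q.
Proof. by rewrite /path_weight /= big_cons. Qed.

Lemma path_sum_walks m (x : point) : x.2 - x.1 - (v.2 - v.1) <= 2 * m%:Z ->
  path_sum x = \sum_(q <- walks m x) path_weight a b x q.
Proof.
move=> xm; rewrite fsbig_seq ?walks_uniq //; apply: eq_fsbigl; apply/seteqP; split=> q /=.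
  move=> [pq lq]; rewrite walksP pq lq eqxx /=.
  by have := dr_path_size pq; rewrite lq; move: (size q) => s; lia.
by rewrite walksP => /and3P[pq /eqP lq _].
Qed.

Lemma path_sum_rec x :
  path_sum x = (x == v)%:R + \sum_(y <- dr_successors x) dr_weight a b x y * path_sum y.
Proof.
pose m := absz (x.2 - x.1 - (v.2 - v.1))%R.
rewrite (@path_sum_walks m.+1); last by rewrite /m; lia.
rewrite /= big_cat; congr (_ + _).
  by case: eqVneq => _; rewrite ?big_nil // big_seq1 /path_weight big_nil.
rewrite big_allpairs_dep; apply: eq_big_seq => y; rewrite dr_successorsP => st.
rewrite (@path_sum_walks m); last by have := dr_step_measure st; rewrite /m; lia.
by rewrite mulr_sumr; apply: eq_bigr => q _; rewrite path_weight_cons.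
Qed.

End PathSums.

(** * The real Kasteleyn matrix *)

Lemma i_neq0 (R : rcfType) : 'i%C != 0 :> R[i].
Proof. by rewrite eq_complex /= oner_eq0 andbF. Qed.

Lemma expi_fourth_root (R : rcfType) (z : int) :
  ('i%C : R[i]) ^ z \in [:: 1; -1; 'i%C; - 'i%C].
Proof.
have i2 : ('i%C : R[i]) * 'i%C = -1 by rewrite -expr2 sqr_i.
have iV : ('i%C : R[i])^-1 = - 'i%C.
  by apply: (mulfI (i_neq0 R)); rewrite mulfV ?i_neq0 // mulrN i2 opprK.
have mul_i c : c \in [:: 1; -1; 'i%C; - 'i%C] -> 'i%C * c \in [:: 1; -1; 'i%C; - 'i%C : R[i]].
  by rewrite !inE => /or4P[] /eqP ->; rewrite ?mulr1 ?mulrN1 ?mulrN ?i2 ?opprK eqxx ?orbT.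
have nat_pow k : ('i%C : R[i]) ^+ k \in [:: 1; -1; 'i%C; - 'i%C].
  by elim: k => [|k IH]; [rewrite expr0 inE eqxx | rewrite exprS mul_i].
case: z => k; rewrite ?NegzE -?exprnP // -exprnN -exprVn iV exprNn.
by have := nat_pow k.+1; rewrite -signr_odd; case: odd;
  rewrite ?expr0 ?mul1r // expr1 mulN1r !inE => /or4P[] /eqP ->; rewrite ?opprK eqxx ?orbT.
Qed.

Section Gauge.
Variables (R : realType) (a b : int -> int -> R).

(** Around every face the signs below and the Kasteleyn phases have the same
    alternating product, so the two matrices differ by diagonal factors. Here the
    edge (-1,1) gets the sign opposite to the one of the edges that the steps of
    the DR graph stand for. *)
Definition real_kasteleyn (x y : point) : R :=
  (y == x + (-1, 1))%:R - (y == x + (-1, -1))%:R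
  - a (halfx x) (halfy x) * (y == x + (1, 1))%:R
  - b (halfx x) (halfy x) * (y == x + (1, -1))%:R.

Definition black_phase (x : point) : R[i] := 'i%C ^ (3 - halfx x + halfy x).
Definition white_phase (y : point) : R[i] := 'i%C ^ (halfx y - halfy y).

Lemma kasteleyn_gauge (r s : int) y : let x := (2 * r, 2 * s + 1) in
  kasteleyn a b x y = black_phase x * white_phase y * (real_kasteleyn x y)%:C%C.
Proof.
move=> x.
rewrite /kasteleyn /real_kasteleyn /black_phase /white_phase.
have -> : halfx x = r by rewrite /halfx half_double.
have -> : halfy x = s by rewrite /halfy half_double1.
rewrite -expfzDr ?i_neq0 //.
have eqxy z : (y - x == z) = (y == x + z) by rewrite subr_eq addrC.
rewrite !eqxy {eqxy} /x !pairD.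
have i2 : 'i%C ^ 2 = -1 :> R[i] by rewrite -exprnP sqr_i.
have i3 : 'i%C ^ 3 = - 'i%C :> R[i] by rewrite -exprnP exprSr sqr_i mulN1r.
have rF : (2 * r + -1 == 2 * r + 1) = false by lia.
have sF : (2 * s + 1 + -1 == 2 * s + 1 + 1) = false by lia.
have neqE := (xpair_eqE, rF, sF, eq_sym (2 * r + 1), eq_sym (2 * s + 1 + 1), eqxx).
have [->|n1] := eqVneq y (2 * r + -1, 2 * s + 1 + -1).
  rewrite (_ : 3 - r + s + _ = 2); last by rewrite /halfx /halfy /=; lia.
  by rewrite !neqE i2 /= !mulr0 !subr0 sub0r rmorphN rmorph1 mulrNN mulr1.
have [->|n2] := eqVneq y (2 * r + -1, 2 * s + 1 + 1).
  rewrite (_ : 3 - r + s + _ = 1); last by rewrite /halfx /halfy /=; lia.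
  by rewrite !neqE expr1z /= !mulr0 !subr0 mulr1.
have [->|n3] := eqVneq y (2 * r + 1, 2 * s + 1 + 1).
  rewrite (_ : 3 - r + s + _ = 2); last by rewrite /halfx /halfy /=; lia.
  by rewrite !neqE i2 /= mulr0 mulr1 !subr0 sub0r rmorphN mulN1r opprK.
have [->|n4] := eqVneq y (2 * r + 1, 2 * s + 1 + -1).
  rewrite (_ : 3 - r + s + _ = 3); last by rewrite /halfx /halfy /=; lia.
  by rewrite i3 /= mulr0 mulr1 !subr0 sub0r rmorphN mulrNN.
by rewrite /= !mulr0 !subr0 mulr0.
Qed.
End Gauge.

Section White.
Variables (R : realType) (n p : nat) (a b : int -> int -> R).
Hypothesis n_gt1 : (1 < n)%N.
Variable M : nat.
Hypothesis M_eq : M = tower_size n p.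

(** Extension by zero to all points of a function on the white vertices, given in
    the coordinates of their enumeration: boundary rows of the matrix then need no
    separate treatment. *)
Definition white_extend (f : 'I_M -> R) (y : point) : R :=
  \sum_(j < M) (wvert n p j.+1 == y)%:R * f j.

Lemma white_extend_out f y : ~~ white n p y -> white_extend f y = 0.
Proof.
move=> yw; apply: big1 => j _; case: eqP => [wy|]; last by rewrite mul0r.
by move: yw; rewrite -wy white_wvert // -M_eq.
Qed.

Lemma white_extend_wvert f (j : 'I_M) : white_extend f (wvert n p j.+1) = f j.
Proof.
rewrite /white_extend (bigD1 j) //= eqxx mul1r big1 ?addr0 // => i ij.
case: eqP => [/wvert_inj e|]; last by rewrite mul0r.
by rewrite (val_inj (e _ _ _)) ?eqxx // -?M_eq // in ij.
Qed.

Lemma white_extendE (F : point -> R) y :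
  white_extend (fun j => F (wvert n p j.+1)) y = (white n p y)%:R * F y.
Proof.
have [yw|yw] := boolP (white n p y); last by rewrite white_extend_out // mul0r.
have [i iN <-] := wvert_surj n_gt1 yw; rewrite -M_eq in iN.
by rewrite (white_extend_wvert _ (Ordinal iN)) mul1r.
Qed.

Lemma real_kasteleyn_sum f x :
  \sum_(j < M) real_kasteleyn a b x (wvert n p j.+1) * f j =
  white_extend f (x + (-1, 1)) - white_extend f (x + (-1, -1))
  - a (halfx x) (halfy x) * white_extend f (x + (1, 1))
  - b (halfx x) (halfy x) * white_extend f (x + (1, -1)).
Proof.
rewrite /white_extend !mulr_sumr -!sumrB; apply: eq_bigr => j _.
by rewrite /real_kasteleyn; ring.
Qed.

Lemma dr_vertexE (j k : int) : dr_vertex n p (2 * j, 2 * k - 1) =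
  (0 <= j <= n%:Z) && (- p%:Z <= k <= n%:Z)
  || (1 <= j <= n%:Z) && (- p%:Z - n%:Z + 1 <= k <= - p%:Z - 1).
Proof.
rewrite /dr_vertex (_ : drj _ = j); last by rewrite /drj /=; lia.
by rewrite (_ : drk _ = k) ?eqxx //; rewrite /drk /=; lia.
Qed.

(** At a black vertex the conditions on the DR edge follow from those on the
    dimer, so that a step exists exactly when the dimer has a white end. *)
Lemma dr_step_white (x : point) : black n p x ->
  [/\ dr_step n p x (x + (2, 0)) = white n p (x + (1, 1)),
      dr_step n p x (x + (0, -2)) = white n p (x + (-1, -1)) &
      dr_step n p x (x + (2, -2)) = white n p (x + (1, -1))].
Proof.
move=> bx; have [r [s [xE _ _]]] := black_coord bx; subst x.
have shift d : (2 * r, 2 * s + 1) + d - (2 * r, 2 * s + 1) = d :> point by rewrite addrC addKr.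
have drjE : drj (2 * r, 2 * s + 1) = r by rewrite /drj /=; lia.
have drkE : drk (2 * r, 2 * s + 1) = s + 1 by rewrite /drk /=; lia.
rewrite /dr_step /tower_edge bx /dr_dimer !shift /= /dr_edge.
rewrite /dr_horizontal /dr_vertical /dr_diagonal !shift drjE drkE.
rewrite !pairD (_ : (2 * r, 2 * s + 1) = (2 * r, 2 * (s + 1) - 1)); last by congr pair; lia.
rewrite (_ : (2 * r + 2, 2 * s + 1 + 0) = (2 * (r + 1), 2 * (s + 1) - 1)); last by congr pair; lia.
rewrite (_ : (2 * r + 2, 2 * s + 1 + -2) = (2 * (r + 1), 2 * s - 1)); last by congr pair; lia.
rewrite (_ : (2 * r + 0, 2 * s + 1 + -2) = (2 * r, 2 * s - 1)); last by congr pair; lia.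
rewrite (_ : (2 * r + 1, 2 * s + 1 + 1) = (2 * r + 1, 2 * (s + 1))); last by congr pair; lia.
rewrite (_ : (2 * r + 1, 2 * s + 1 + -1) = (2 * r + 1, 2 * s)); last by congr pair; lia.
rewrite (_ : (2 * r + -1, 2 * s + 1 + -1) = (2 * (r - 1) + 1, 2 * s)); last by congr pair; lia.
rewrite !dr_vertexE !whiteE !inE !xpair_eqE !andbT !orbF /=.
by move: bx; rewrite blackE => bx; split; lia.
Qed.

Lemma path_sum_black v (x : point) : black n p x ->
  let T y := (white n p y)%:R * path_sum n p a b v (y + (1, -1)) in
  path_sum n p a b v x = (x == v)%:R + T (x + (-1, -1)) +
    a (halfx x) (halfy x) * T (x + (1, 1)) +  b (halfx x) (halfy x) * T (x + (1, -1)).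
Proof.
move=> bx T; have [e1 e2 e3] := dr_step_white bx.
have shift d : x + d - x = d :> point by rewrite addrC addKr.
rewrite [LHS]path_sum_rec /dr_successors big_filter !big_cons big_nil e1 e2 e3.
rewrite /dr_weight !shift /= /T -!addrA /=.
by do 3 case: white; rewrite /= ?(mul1r, mul0r, mulr0, add0r, addr0) //; ring.
Qed.

(** The edge (-1,1) contributes the path count at x, when it is present, and the
    three other edges subtract the terms of its first-step decomposition. *)
Lemma real_kasteleyn_path_sum v (x : point) : black n p x ->
  \sum_(j < M) real_kasteleyn a b x (wvert n p j.+1) * path_sum n p a b v (wvert n p j.+1 + (1, -1)) =
  (x == v)%:R - (~~ white n p (x + (-1, 1)))%:R * path_sum n p a b v x.
Proof.
move=> bx; rewrite real_kasteleyn_sum.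
rewrite !(white_extendE (fun y => path_sum n p a b v (y + (1, -1)))).
have -> : x + (-1, 1) + (1, -1) = x by rewrite -addrA pairD addr0.
have := path_sum_black v bx; case: (white n p (x + (-1, 1))) => /=; lra.
Qed.

End White.

Section Kernel.
Variables (R : realType) (n p : nat) (a b : int -> int -> R).
Hypothesis n_gt1 : (1 < n)%N.
Hypothesis a_gt0 : forall r s : int, 0 < a r s.
Hypothesis b_gt0 : forall r s : int, 0 < b r s.
Variable M : nat.
Hypothesis M_eq : M = tower_size n p.

Definition real_kasteleyn_mx : 'M[R]_M :=
  \matrix_(i, j) real_kasteleyn a b (bvert n p i.+1) (wvert n p j.+1).

(** Column j of white vertices is shifted so that its lowest position is t = 0;
    the value below it is 0, as the convention for prev at t = 0 requires. *)
Lemma real_kasteleyn_ker (f : 'I_M -> R) :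
  (forall i : 'I_M,
     \sum_(j < M) real_kasteleyn a b (bvert n p i.+1) (wvert n p j.+1) * f j = 0) ->
  forall j, f j = 0.
Proof.
move=> ker_f; pose g := white_extend n p f.
have g_out y : ~~ white n p y -> g y = 0 by apply: white_extend_out.
have eq_g (r s : int) : black n p (2 * r, 2 * s + 1) ->
    g (2 * (r - 1) + 1, 2 * (s + 1)) - g (2 * (r - 1) + 1, 2 * s)
    - a r s * g (2 * r + 1, 2 * (s + 1)) - b r s * g (2 * r + 1, 2 * s) = 0.
  case/bvert_surj => // i iN bi; rewrite -M_eq in iN.
  rewrite -(ker_f (Ordinal iN)) /= bi real_kasteleyn_sum !pairD.
  rewrite /halfx /halfy half_double half_double1.
  rewrite (_ : 2 * r + -1 = 2 * (r - 1) + 1); last by lia.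
  rewrite (_ : 2 * s + 1 + 1 = 2 * (s + 1)); last by lia.
  by rewrite (_ : 2 * s + 1 + -1 = 2 * s); last by lia.
pose s0 (t : nat) : int := t%:Z - p%:Z - n%:Z.
pose u (j t : nat) : R := g (2 * j%:Z + 1, 2 * (s0 t + 1)).
have prev_u j t : prev (u j) t = g (2 * j%:Z + 1, 2 * s0 t).
  case: t => [|t] /=; last by rewrite /u /s0; congr (g (_, _)); lia.
  by rewrite g_out // whiteE /s0; lia.
have u0 : forall j t : nat, (j < n)%N -> (t < 2 * n + p)%N -> u j t = 0.
  apply: (@columns_eq0 _ n p u (fun j t => a j%:Z (s0 t)) (fun j t => b j%:Z (s0 t))) => //; first by lia.
  - move=> t tM; rewrite prev_u.
    have := eq_g 0 (s0 t); rewrite blackE /u.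
    by rewrite !(g_out (2 * (0 - 1) + 1, _)) ?whiteE //; move=> /(_ ltac:(rewrite /s0; lia)); lra.
  - move=> j t jn tM; rewrite !prev_u.
    have := eq_g j.+1%:Z (s0 t); rewrite blackE /u.
    rewrite (_ : j.+1%:Z - 1 = j%:Z); last by lia.
    by move=> /(_ ltac:(rewrite /s0; lia)); lra.
  - move=> t tM; rewrite prev_u.
    have := eq_g n%:Z (s0 t); rewrite blackE /u.
    rewrite (_ : n%:Z - 1 = n.-1%:Z); last by lia.
    by rewrite !(g_out (2 * n%:Z + 1, _)) ?whiteE; [move=> /(_ ltac:(rewrite /s0; lia)); lra|lia|lia].
move=> j; rewrite -(white_extend_wvert n_gt1 M_eq f j) -/g.
have [j0 [k [-> jn kn]]] := white_coord (white_wvert n_gt1 (ltn_ord (cast_ord M_eq j))).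
have := u0 (absz j0) (absz (k - 1 + p%:Z + n%:Z)%R) ltac:(lia) ltac:(lia).
by rewrite /u /s0 => <-; congr (g (_, _)); lia.
Qed.

Lemma real_kasteleyn_unit : real_kasteleyn_mx \in unitmx.
Proof.
rewrite -unitmx_tr -row_free_unit; apply: inj_row_free => v v0.
apply/rowP => j; rewrite mxE; apply: (@real_kasteleyn_ker (fun j => v 0 j)) => i.
transitivity ((v *m real_kasteleyn_mx^T) 0 i); last by rewrite v0 mxE.
by rewrite mxE; apply: eq_bigr => k _; rewrite !mxE mulrC.
Qed.

End Kernel.

(** * Block matrices with a vanishing corner *)

Section Blocks.
Variables (F : fieldType) (m1 m2 : nat).
Variables (B : 'M[F]_(m1, m2)) (C : 'M[F]_(m2, m1)) (D : 'M[F]_m2).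
Hypothesis D_unit : D \in unitmx.
Let W : 'M_m1 := - (B *m invmx D *m C).
Let M := block_mx 0 B C D.

Lemma det_schur : \det M = \det W * \det D.
Proof.
have -> : M = block_mx 1%:M (B *m invmx D) 0 1%:M *m block_mx W 0 C D.
  rewrite mulmx_block !mul1mx !mul0mx !add0r /W.
  by rewrite mulmxKV // addNr.
by rewrite det_mulmx det_ublock det_lblock !det1 !mul1r.
Qed.

Lemma invmx_schur : W \in unitmx ->
  invmx M = block_mx (invmx W) (- (invmx W *m B *m invmx D))
    (- (invmx D *m C *m invmx W))
    (invmx D + invmx D *m C *m invmx W *m B *m invmx D).
Proof.
move=> W_unit; set cand := (RHS).
have M_unit : M \in unitmx by rewrite unitmxE det_schur unitrM -!unitmxE W_unit.
suff e : M *m cand = 1%:M by rewrite -[cand](mulKmx M_unit) e mulmx1.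
have BDC : B *m invmx D *m C = - W by rewrite opprK.
clearbody W.
rewrite /cand mulmx_block !mul0mx !add0r !mulmxN !mulmxDr !mulmxA (mulmxV D_unit) BDC.
by rewrite !mul1mx !mulNmx (mulmxV W_unit) !mul1mx opprK !subrr [_ + (1%:M + _)]addrC addrK [RHS]scalar_mx_block.
Qed.

End Blocks.

(** * The Schur complement of the tower *)

Section Split.
Variables (R : realType) (n p : nat) (n_gt0 : (0 < n)%N).

Lemma tower_split_det (M : 'M[R[i]]_(tower_size n p)) : \det (tower_split n_gt0 M) = \det M.
Proof. by rewrite /tower_split; case: _ / (tower_size_split p n_gt0); rewrite castmx_id. Qed.

Lemma tower_split_invmx (M : 'M[R[i]]_(tower_size n p)) :
  tower_split n_gt0 (invmx M) = invmx (tower_split n_gt0 M).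
Proof. by rewrite /tower_split; case: _ / (tower_size_split p n_gt0); rewrite !castmx_id. Qed.

Lemma tower_split_kasteleyn a b i j :
  tower_split n_gt0 (kasteleyn_mx n p a b) i j = kasteleyn a b (bvert n p i.+1) (wvert n p j.+1) :> R[i].
Proof. by rewrite /tower_split castmxE mxE. Qed.
End Split.

Section Tower.
Variables (R : realType) (n p : nat) (a b : int -> int -> R).
Hypothesis n_gt1 : (1 < n)%N.
Hypothesis a_gt0 : forall r s : int, 0 < a r s.
Hypothesis b_gt0 : forall r s : int, 0 < b r s.

Let K := tower_split (ltnW n_gt1) (kasteleyn_mx n p a b).
Let M := (n + p + tail_size n p)%N.
Let M_eq : M = tower_size n p := esym (tower_size_split p (ltnW n_gt1)).

Lemma kasteleyn_entry (i j : 'I_M) : K i j =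
  black_phase R (bvert n p i.+1) * white_phase R (wvert n p j.+1)
  * (real_kasteleyn a b (bvert n p i.+1) (wvert n p j.+1))%:C.
Proof.
rewrite tower_split_kasteleyn.
have : black n p (bvert n p i.+1) by apply: black_bvert => //; rewrite -M_eq.
by case/black_coord => r [s [-> _ _]]; apply: kasteleyn_gauge.
Qed.

Lemma det_split_neq0 : \det K != 0.
Proof.
have -> : K = diag_mx (\row_i black_phase R (bvert n p i.+1)) *m
    map_mx (real_complex R) (real_kasteleyn_mx n p a b M) *m
    diag_mx (\row_j white_phase R (wvert n p j.+1)).
  by apply/matrixP => i j; rewrite mul_mx_diag mul_diag_mx !mxE kasteleyn_entry mulrAC.
rewrite !det_mulmx !det_diag det_map_mx !mulf_neq0 //.
- by apply/prodf_neq0 => i _; rewrite mxE expfz_neq0 // i_neq0.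
- have := real_kasteleyn_unit n_gt1 a_gt0 b_gt0 M_eq.
  by rewrite unitmxE unitfE fmorph_eq0.
- by apply/prodf_neq0 => i _; rewrite mxE expfz_neq0 // i_neq0.
Qed.

Lemma ulsubmx_kasteleyn : ulsubmx K = 0.
Proof.
apply/matrixP => i j; rewrite !mxE tower_split_kasteleyn bvert_head ?wvert_head //=.
have far1 : (2 * n%:Z - 1 - 0 == 1) = false by lia.
have farN1 : (2 * n%:Z - 1 - 0 == -1) = false by lia.
by rewrite /kasteleyn pairB !xpair_eqE far1 farN1.
Qed.

(** The white neighbours of a black vertex x other than x + (-1,1) come later than
    x + (-1,1) in the row by row order. *)
Lemma det_drsubmx_kasteleyn : \det (drsubmx K) = 'i%C ^+ tail_size n p.
Proof.
rewrite -det_tr det_trig.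
  rewrite -[X in _ ^+ X]card_ord -prodr_const; apply: eq_bigr => t _.
  rewrite !mxE tower_split_kasteleyn /= wvert_tail //; last first.
    by rewrite -M_eq leq_addr ltn_add2l ltn_ord.
  by rewrite /kasteleyn addrC addKr.
apply/is_trig_mxP => t' t tt; rewrite !mxE tower_split_kasteleyn /=.
have tail_lt : (n + p + t < tower_size n p)%N by rewrite -M_eq ltn_add2l.
have lt_tail : (n + p + t' < n + p + t < tower_size n p)%N by rewrite ltn_add2l tt.
have /= := wvert_tail_lex n_gt1 (leq_addr t' (n + p)) lt_tail.
rewrite (@wvert_tail _ _ n_gt1 (n + p + t)%N); last by rewrite leq_addr.
move: (bvert _ _ _) (wvert _ _ _) => [x1 x2] [y1 y2].
rewrite /kasteleyn pairD pairB !xpair_eqE /= => lex.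
by do 4 (rewrite ifF; last by lia).
Qed.

Definition lgv_target (j : nat) : point := (2 * n%:Z, 1 - 2 * j.+1%:Z).

Lemma path_sum_target v j :
  path_sum n p a b v (lgv_target j) = (lgv_target j == v)%:R.
Proof.
rewrite path_sum_rec (_ : dr_successors _ _ _ = [::]) ?big_nil ?addr0 //.
have targetF : black n p (lgv_target j) = false.
  by rewrite /lgv_target (_ : 1 - 2 * j.+1%:Z = 2 * - j.+1%:Z + 1) ?blackE; lia.
apply/eqP; rewrite -size_eq0 size_filter -leqn0 leqNgt -has_count.
by apply/hasPn => y _; rewrite /dr_step /tower_edge targetF andbF.
Qed.

(** The phases undo the gauge and normalize the head rows to the identity; the
    tail rows then turn out to be - D^-1 C. *)
Definition path_mx : 'M[R[i]]_(M, n + p) :=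
  \matrix_(i, j) ((white_phase R (wvert n p i.+1))^-1 * white_phase R (wvert n p j.+1)
    * (path_sum n p a b (lgv_target j) (wvert n p i.+1 + (1, -1)))%:C).

Lemma white_phase_neq0 y : white_phase R y != 0.
Proof. by rewrite expfz_neq0 ?i_neq0. Qed.

Lemma wvert_head_target j : (j < n + p)%N -> wvert n p j.+1 + (1, -1) = lgv_target j.
Proof. by move=> jn; rewrite wvert_head // pairD; congr pair; lia. Qed.

Lemma usubmx_path_mx : usubmx path_mx = 1%:M.
Proof.
apply/matrixP => i j; rewrite !mxE /= wvert_head_target // path_sum_target.
have -> : (lgv_target i == lgv_target j) = (i == j).
  by rewrite /lgv_target xpair_eqE eqxx -val_eqE /=; lia.
by case: eqVneq => [->|]; rewrite ?mulr0 //= mulVf ?mul1r // white_phase_neq0.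
Qed.

Lemma kasteleyn_path_mx (i : 'I_M) j :
  (K *m path_mx) i j = black_phase R (bvert n p i.+1) * white_phase R (wvert n p j.+1) *
   (- ((~~ white n p (bvert n p i.+1 + (-1, 1)))%:R
      * path_sum n p a b (lgv_target j) (bvert n p i.+1)))%:C.
Proof.
have bi : black n p (bvert n p i.+1) by apply: black_bvert => //; rewrite -M_eq.
have biF : (bvert n p i.+1 == lgv_target j) = false.
  apply: contraTF bi => /eqP ->.
  by rewrite /lgv_target (_ : 1 - 2 * j.+1%:Z = 2 * - j.+1%:Z + 1) ?blackE; lia.
rewrite -[- _]add0r -[0 in X in X%:C](_ : (bvert n p i.+1 == lgv_target j)%:R = _ :> R); last by rewrite biF.
rewrite -(real_kasteleyn_path_sum _ _ n_gt1 M_eq _ bi) mxE rmorph_sum mulr_sumr.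
apply: eq_bigr => k _; rewrite kasteleyn_entry mxE rmorphM /=.
by field; rewrite white_phase_neq0.
Qed.

Let B := ursubmx K.
Let C := dlsubmx K.
Let D := drsubmx K.
Let W := - (B *m invmx D *m C).

Lemma drsubmx_kasteleyn_unit : D \in unitmx.
Proof. by rewrite unitmxE det_drsubmx_kasteleyn unitfE expf_neq0 // i_neq0. Qed.

(** The block form of kasteleyn_path_mx: the tail rows say that the lower part X
    of path_mx satisfies C + D X = 0, and the head rows that B X is the matrix of
    path counts, up to the gauge. *)
Lemma schur_lgv i j : W i j =
  - (black_phase R (bvert n p i.+1) * white_phase R (wvert n p j.+1)) * (lgv_mx n p a b i j)%:C.
Proof.
have K_path : K *m path_mx = col_mx (B *m dsubmx path_mx) (C + D *m dsubmx path_mx).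
  rewrite -[path_mx in LHS]vsubmxK usubmx_path_mx -[K]submxK ulsubmx_kasteleyn.
  by rewrite mul_block_col mul0mx add0r mulmx1.
have CD : C = - (D *m dsubmx path_mx).
  apply/eqP; rewrite -addr_eq0; apply/eqP/matrixP => t k.
  rewrite -(col_mxEd (B *m dsubmx path_mx)) -K_path kasteleyn_path_mx [RHS]mxE.
  have tail : (n + p <= rshift (n + p) t < tower_size n p)%N by rewrite -M_eq leq_addr ltn_ord.
  rewrite -(wvert_tail n_gt1 tail) (white_wvert n_gt1) ?mul0r ?oppr0 ?mulr0 //.
  by case/andP: tail.
rewrite /W CD mulmxN opprK -mulmxA mulKmx ?drsubmx_kasteleyn_unit // -(col_mxEu _ (C + D *m dsubmx path_mx)) -K_path.
rewrite kasteleyn_path_mx /= (_ : white _ _ _ = false) ?mul1r ?rmorphN ?mulrN ?mulNr.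
  by rewrite [lgv_mx _ _ _ _ _ _]mxE /path_sum /bvert ltn_ord.
rewrite bvert_head // pairD /white /halfx /=; lia.
Qed.

End Tower.

Theorem theorem4p3 (R : realType) (n p : nat) (a b : int -> int -> R)
    (n_gt1 : (1 < n)%N) (p_gt0 : (0 < p)%N)
    (a_gt0 : forall r s : int, 0 < a r s)
    (b_gt0 : forall r s : int, 0 < b r s) :
  let K := kasteleyn_mx n p a b in
  let B := ursubmx (tower_split (ltnW n_gt1) K) in
  let C := dlsubmx (tower_split (ltnW n_gt1) K) in
  let D := drsubmx (tower_split (ltnW n_gt1) K) in
  let W := - (B *m invmx D *m C) in
  [/\ D \in unitmx, W \in unitmx & K \in unitmx] /\
  [/\ forall i j : 'I_(n + p), exists2 s : R[i],
        s \in [:: 1; -1; 'i%C; - 'i%C] & W i j = s * (lgv_mx n p a b i j)%:C,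
      `|\det W| = `|\det K|
    & tower_split (ltnW n_gt1) (invmx K) =
        block_mx
          (invmx W)
          (- (invmx W *m B *m invmx D))
          (- (invmx D *m C *m invmx W))
          (invmx D + invmx D *m C *m invmx W *m B *m invmx D)].
Proof.
move=> K B C D W.
have Du : D \in unitmx by apply: drsubmx_kasteleyn_unit.
have Ksplit : tower_split (ltnW n_gt1) K = block_mx 0 B C D.
  by rewrite -[LHS]submxK ulsubmx_kasteleyn.
have detK : \det K = \det W * \det D.
  by rewrite -(tower_split_det (ltnW n_gt1)) Ksplit det_schur.
have K_neq0 : \det K != 0.
  by rewrite -(tower_split_det (ltnW n_gt1)) det_split_neq0.
have Wu : W \in unitmx.
  by rewrite unitmxE unitfE; apply: contraNneq K_neq0 => W0; rewrite detK W0 mul0r.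
split; first by rewrite unitmxE unitfE.
split.
- move=> i j; rewrite schur_lgv.
  exists (- (black_phase R (bvert n p i.+1) * white_phase R (wvert n p j.+1))) => //.
  have := expi_fourth_root R
    (3 - halfx (bvert n p i.+1) + halfy (bvert n p i.+1)
     + (halfx (wvert n p j.+1) - halfy (wvert n p j.+1))).
  rewrite expfzDr ?i_neq0 // !inE => /or4P[] /eqP ->;
    by rewrite ?opprK eqxx ?orbT.
- have norm_i : `|'i%C : R[i]| = 1.
    by apply/eqP; rewrite -sqrp_eq1 // -normrX sqr_i normrN1.
  by rewrite detK det_drsubmx_kasteleyn normrM normrX norm_i expr1n mulr1.
- by rewrite tower_split_invmx Ksplit invmx_schur.
Qed.
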